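(* Let $n\geq 1$ be an integer and $\mathbb{F}=\{1,-1\}$. The number of maximal ascending chains in the total preorder $(\mathbb{F}^n,\preceq)$, where $u\preceq v$ if and only if $\mathcal{S}_u\leq\mathcal{S}_v$, is $$\prod_{k=0}^{n-1}\left(2\binom{n-1}{k}\right)!\,.$$
   Context: The sequency of $v=[v_0\ v_1\ \cdots\ v_{n-1}]^T\in\mathbb{F}^n$ is $\mathcal{S}_v=\frac12\sum_{k=0}^{n-2}|v_k-v_{k+1}|$ (the number of sign changes). A chain $C$ in a preorder is a subset such that for any $x,y\in C$, either $x\preceq y$ or $y\preceq x$. A chain is maximal if it is not a proper subset of any other chain. An ascending chain $(a_0,a_1,\ldots,a_{N-1})$ is a sequence formed by the elements of a chain (each element of the chain listed exactly once) satisfying $a_i\preceq a_{i+1}$ for all $i\in\{0,\ldots,N-2\}$. A maximal ascending chain is an ascending chain formed by the elements of a maximal chain; two maximal ascending chains are different if they are different as sequences. *)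

(* Defs.v *)
From mathcomp Require Import all_boot all_order all_algebra.

Set Implicit Arguments.
Unset Strict Implicit.
Unset Printing Implicit Defensive.

Import Order.TTheory GRing.Theory Num.Theory.

Section Chains.

Variables (T : finType) (r : rel T).

Definition chain (C : {set T}) : bool :=
  [forall x in C, forall y in C, r x y || r y x].

Definition maximal_chain (C : {set T}) : bool := maxset chain C.

Definition ascending_chain (s : seq T) : bool :=
  [&& uniq s, chain [set x in s] & sorted r s].

Definition maximal_ascending_chain (s : seq T) : bool :=
  ascending_chain s && maximal_chain [set x in s].

(* The bound #|T| in max_ascending_chains loses no sequence. *)
Lemma size_ascending_chain (s : seq T) : ascending_chain s -> size s <= #|T|.
Proof. by case/and3P=> /card_uniqP <- _ _; apply: max_card. Qed.

Definition max_ascending_chains : {set {bseq #|T| of T}} :=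
  [set s : {bseq #|T| of T} | maximal_ascending_chain s].

Lemma max_ascending_chainsP (s : seq T) :
  reflect (exists2 b, b \in max_ascending_chains & bseqval b = s)
          (maximal_ascending_chain s).
Proof.
apply: (iffP idP) => [sP | [b + <-]]; last by rewrite inE.
have /andP[/size_ascending_chain s_le _] := sP.
by exists (Bseq s_le); rewrite ?inE.
Qed.

End Chains.

Local Open Scope ring_scope.

Definition sign : finType := seq_sub [:: 1; -1 : int].

Section Sequency.

Variable n : nat.

Definition ord_cur (k : 'I_n.-1) : 'I_n := widen_ord (leq_pred n) k.

Fact ord_next_subproof (k : 'I_n.-1) : (k.+1 < n)%N.
Proof. by rewrite -ltn_predRL. Qed.

Definition ord_next (k : 'I_n.-1) : 'I_n := Ordinal (ord_next_subproof k).

Definition sequency (v : sign ^ n) : rat :=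
  2^-1 * (\sum_(k < n.-1) `|val (v (ord_cur k)) - val (v (ord_next k))|)%:~R.

Definition sequency_le : rel (sign ^ n) := fun u v => sequency u <= sequency v.

Lemma sequency_le_refl : reflexive sequency_le.
Proof. by move=> u; apply: lexx. Qed.

Lemma sequency_le_trans : transitive sequency_le.
Proof. by move=> v u w; apply: le_trans. Qed.

Lemma sequency_le_total : total sequency_le.
Proof. by move=> u v; apply: le_total. Qed.

End Sequency.

(* Main.v *)
Require Import Defs.
From mathcomp Require Import all_boot all_order all_algebra.

(** The preorder is total, so the whole of [sign ^ n] is a chain, hence the only
maximal one: a maximal ascending chain is exactly a listing of [sign ^ n],
without repetition, along which the sequency does not decrease
([maximal_ascending_chain_total]).

Such a listing is obtained by listing the vectors of sequency 0 in any order,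
followed by those of sequency 1 in any order, and so on.  If [c k] vectors have
sequency [k], there are therefore [\prod_k (c k)`!] listings
([size_graded_listings]).

Finally, the sequency of [v] is the number of positions at which [v] changes
sign, and [v] is determined by its first entry together with the set of these
positions ([sign_changes_bij]).  Both can be prescribed arbitrarily, so there
are 2 choices for the first entry and ['C(n - 1, k)] for a set of [k] positions:
[c k = 2 * 'C(n - 1, k)] ([card_sign_changes]). *)

Set Implicit Arguments.
Unset Strict Implicit.
Unset Printing Implicit Defensive.

Import GRing.Theory Num.Theory.

Lemma maximal_chain_total (T : finType) (r : rel T) (C : {set T}) :
  total r -> maximal_chain r C = (C == setT).
Proof.
move=> r_total.
have chain_all A : chain r A.
  by apply/'forall_implyP => x _; apply/'forall_implyP => y _; apply: r_total.
apply/maxsetP/eqP => [[_ maxC] | ->].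
  by rewrite -(maxC setT (chain_all _) (subsetT _)).
by split=> // B _; rewrite subTset => /eqP.
Qed.

Lemma maximal_ascending_chain_total (T : finType) (r : rel T) (s : seq T) :
  total r ->
  maximal_ascending_chain r s = perm_eq s (enum T) && sorted r s.
Proof.
move=> r_total; rewrite /maximal_ascending_chain /ascending_chain.
rewrite maximal_chain_total // andbC.
have -> : chain r [set x in s].
  by apply/'forall_implyP => x _; apply/'forall_implyP => y _; apply: r_total.
rewrite andTb andbA; congr (_ && _).
apply/andP/idP => [[/eqP sT s_uniq] | s_perm].
  apply: uniq_perm => //; first exact: enum_uniq.
  by move=> x; move/setP/(_ x): sT; rewrite !inE mem_enum.
split; last by rewrite (perm_uniq s_perm) enum_uniq.
by apply/eqP/setP => x; rewrite !inE (perm_mem s_perm) mem_enum.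
Qed.

Section GradedListings.

Variables (T : eqType) (f : T -> nat) (s : seq T).

Definition grade_le : rel T := fun x y => f x <= f y.

Lemma grade_le_trans : transitive grade_le.
Proof. by move=> y x z; apply: leq_trans. Qed.

#[local] Hint Resolve grade_le_trans : core.

(** An explicit enumeration rather than a filter of [permutations s]: the choices
made at the successive grades are independent, so the size is visibly a product
of factorials. *)
Fixpoint graded_listings (N : nat) : seq (seq T) :=
  if N is k.+1 then
    [seq t1 ++ t2 | t1 <- graded_listings k,
                    t2 <- permutations [seq x <- s | f x == k]]
  else [:: [::]].

Lemma size_graded_listings (N : nat) : uniq s ->
  size (graded_listings N) = \prod_(0 <= k < N) (count (fun x => f x == k) s)`!.
Proof.
move=> s_uniq; elim: N => [|N IHN]; first by rewrite big_geq.
rewrite big_nat_recr //= size_allpairs IHN.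
by rewrite size_permutations ?filter_uniq // size_filter.
Qed.

(** Cutting a sorted listing where the grade reaches [k] recovers the two factors
from which [graded_listings] builds it. *)
Lemma sorted_grade_split (k : nat) (t : seq T) : sorted grade_le t ->
  t = [seq x <- t | f x < k] ++ [seq x <- t | k <= f x].
Proof.
elim: t => //= x t IHt x_path.
case: (ltnP (f x) k) => [_ | k_le] /=.
  by rewrite -IHt // (path_sorted x_path).
have /allP t_ge : all (grade_le x) t by apply: order_path_min.
have -> : [seq y <- t | f y < k] = [::].
  apply/eqP; rewrite -[_ == _]negbK -has_filter; apply/hasPn => y /t_ge xy.
  by rewrite -leqNgt (leq_trans k_le xy).
by congr cons; apply/esym/all_filterP/allP => y /t_ge; apply: leq_trans.
Qed.

Lemma perm_grade_recr (N : nat) :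
  perm_eq [seq x <- s | f x < N.+1]
          ([seq x <- s | f x < N] ++ [seq x <- s | f x == N]).
Proof.
apply/seq.permP => a; rewrite count_cat !count_filter.
rewrite -count_predUI.
rewrite [X in _ = _ + X](eq_count (a2 := pred0)) => [|x /=]; last first.
  by case: ltngtP; rewrite ?andbF.
rewrite count_pred0 addn0; apply: eq_count => x /=.
by rewrite ltnS leq_eqVlt orbC; case: (a x).
Qed.

(** [graded_listings] misses no sorted listing: a sorted listing of the entries
of grade at most [N] is a sorted listing of those of grade below [N] followed by
an arbitrary one of those of grade [N], on which [grade_le] is no constraint. *)
Lemma mem_graded_listings (N : nat) (t : seq T) :
  (t \in graded_listings N) =
    perm_eq t [seq x <- s | f x < N] && sorted grade_le t.
Proof.
elim: N t => [|N IHN] t /=.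
  have -> : [seq x <- s | f x < 0] = [::] by elim: s.
  rewrite inE; apply/eqP/andP => [-> // | [/perm_size/size0nil -> //]].
apply/allpairsP/andP => [[[t1 t2] /= []] | [t_perm t_sorted]].
  rewrite IHN mem_permutations => /andP[t1_perm t1_sorted] t2_perm ->; split.
    by rewrite (permPr (perm_grade_recr N)) perm_cat.
  have t1_lt x : x \in t1 -> f x < N.
    by rewrite (perm_mem t1_perm) mem_filter => /andP[].
  have t2_eq x : x \in t2 -> f x = N.
    by rewrite (perm_mem t2_perm) mem_filter => /andP[/eqP].
  rewrite sorted_pairwise // pairwise_cat -!sorted_pairwise // t1_sorted /=.
  apply/andP; split.
    by apply/allrelP => x y /t1_lt xN /t2_eq yN; rewrite /grade_le yN ltnW.
  rewrite sorted_pairwise //; elim: t2 {t2_perm} t2_eq => //= x t2 IHt t2_eq.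
  rewrite IHt => [|y y_t2]; last by rewrite t2_eq // inE y_t2 orbT.
  rewrite andbT; apply/allP => y y_t2.
  by rewrite /grade_le !t2_eq // inE ?eqxx // y_t2 orbT.
have t_split := sorted_grade_split N t_sorted.
exists ([seq x <- t | f x < N], [seq x <- t | N <= f x]); split=> //=.
  rewrite IHN sorted_filter // andbT.
  rewrite (perm_trans (perm_filter _ t_perm)) // -filter_predI.
  rewrite (eq_filter (a2 := fun x => f x < N)) // => x /=.
  by case: ltnP => //= /ltnW.
rewrite mem_permutations (perm_trans (perm_filter _ t_perm)) // -filter_predI.
rewrite (eq_filter (a2 := fun x => f x == N)) // => x /=.
by rewrite ltnS andbC -eqn_leq.
Qed.

(** The cut of a listing into its two factors is unique because the length of the
first one is prescribed. *)
Lemma graded_listings_uniq (N : nat) : uniq (graded_listings N).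
Proof.
elim: N => //= N IHN; apply: allpairs_uniq => //; first exact: permutations_uniq.
move=> _ _ /allpairsP[[t1 t2] /= [t1N _ ->]] /allpairsP[[u1 u2] /= [u1N _ ->]].
move: t1N u1N; rewrite !mem_graded_listings => /andP[t1N _] /andP[u1N _] /eqP /=.
rewrite eqseq_cat => [/andP[/eqP-> /eqP->] //|].
by rewrite (perm_size t1N) (perm_size u1N).
Qed.

End GradedListings.

Lemma card_max_ascending_chains (T : finType) (r : rel T) (f : T -> nat)
    (N : nat) :
  (forall x y, r x y = (f x <= f y)) -> (forall x, f x < N) ->
  #|max_ascending_chains r| = \prod_(0 <= k < N) #|[set x | f x == k]|`!.
Proof.
move=> rE f_lt; have r_total : total r by move=> x y; rewrite !rE leq_total.
transitivity (size (graded_listings f (enum T) N)); last first.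
  rewrite size_graded_listings ?enum_uniq //; apply: eq_bigr => k _.
  by rewrite -size_filter cardsE cardE enumT.
rewrite cardE -(size_map (@bseqval _ _)); apply/perm_size/uniq_perm.
- by rewrite map_inj_uniq ?enum_uniq //; apply: val_inj.
- exact: graded_listings_uniq.
move=> t; rewrite mem_graded_listings.
have -> : [seq x <- enum T | f x < N] = enum T.
  by apply/all_filterP/allP => x _; apply: f_lt.
rewrite -(eq_sorted rE) -maximal_ascending_chain_total //.
apply/mapP/max_ascending_chainsP => [[b bP ->] | [b bP <-]].
  by exists b; rewrite // -mem_enum.
by exists b; rewrite // mem_enum.
Qed.

Lemma sign_dist (a b : sign) :
  (`|val a - val b| = (2 * (a != b))%:Z)%R.
Proof.
rewrite -val_eqE; case: a b => [a aP] [b bP] /=.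
by move: aP bP; rewrite !inE => /orP[] /eqP-> /orP[] /eqP->.
Qed.

Lemma sign_neq_inj (a b c : sign) : (a != b) = (a != c) -> b = c.
Proof.
rewrite -!val_eqE => bc; apply/val_inj; move: bc.
case: a b c => [a aP] [b bP] [c cP] /=; move: aP bP cP; rewrite !inE.
by move=> /orP[] /eqP-> /orP[] /eqP-> /orP[] /eqP->.
Qed.

Lemma card_sign : #|sign| = 2.
Proof. by rewrite card_seq_sub. Qed.

Section SignChanges.

Variable m : nat.

Definition sign_changes (v : sign ^ m.+1) : {set 'I_m} :=
  [set k : 'I_m.+1.-1 | v (ord_cur k) != v (ord_next k)].

Lemma sequencyE (v : sign ^ m.+1) : (sequency v = #|sign_changes v|%:R)%R.
Proof.
have -> : #|sign_changes v| = \sum_(k < m.+1.-1) (v (ord_cur k) != v (ord_next k)).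
  by rewrite -sum1dep_card big_mkcond; apply: eq_bigr => k _; case: eqP.
rewrite /sequency; under eq_bigr do rewrite sign_dist.
rewrite -(big_morph Posz PoszD (erefl _)) -big_distrr /= PoszM intrM.
by rewrite mulKf.
Qed.

(** Starting from the first entry, each entry is read off from the previous
one, because there are only two signs; this gives injectivity, and both sides
have [2 ^ m.+1] elements. *)
Lemma sign_changes_bij :
  bijective (fun v : sign ^ m.+1 => (v ord0, sign_changes v)).
Proof.
apply: inj_card_bij => [u v [uv0 /setP uv] |]; last first.
  rewrite card_prod card_ffun card_sign -cardsT -powersetT card_powerset cardsT.
  by rewrite !card_ord expnS.
suff uvE i (i_lt : i < m.+1) : u (Ordinal i_lt) = v (Ordinal i_lt).
  by apply/ffunP => -[i i_lt].
elim: i i_lt => [|i IHi] i_lt.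
  by have -> : Ordinal i_lt = ord0 by apply: val_inj.
have := uv (Ordinal (i_lt : i < m)); rewrite !inE.
have -> : @ord_cur m.+1 (Ordinal (i_lt : i < m)) = Ordinal (ltnW i_lt).
  exact: val_inj.
have -> : @ord_next m.+1 (Ordinal (i_lt : i < m)) = Ordinal i_lt by apply: val_inj.
by rewrite IHi => /sign_neq_inj.
Qed.

Lemma card_sign_changes (k : nat) :
  #|[set v : sign ^ m.+1 | #|sign_changes v| == k]| = 2 * 'C(m, k).
Proof.
rewrite -card_sign -cardsT -[m in 'C(m, k)]card_ord -card_draws -cardsX.
rewrite -(on_card_preimset (onW_bij _ sign_changes_bij)).
by apply: eq_card => v; rewrite !inE.
Qed.

End SignChanges.

Theorem theorem2p2 (n : nat) (hn : (1 <= n)%N) :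
  #|max_ascending_chains (@sequency_le n)|
    = (\prod_(0 <= k < n) (2 * 'C(n - 1, k))`!)%N.
Proof.
case: n hn => // m _; rewrite subSS subn0.
rewrite (@card_max_ascending_chains _ _ (fun v => #|sign_changes v|) m.+1).
- by apply: eq_bigr => k _; rewrite card_sign_changes.
- by move=> u v; rewrite /sequency_le !sequencyE ler_nat.
by move=> v; rewrite ltnS -[m in _ <= m]card_ord max_card.
Qed.
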